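(* Let $N\ge 2$, $d\ge1$, let $f:\mathbb{Z}_N^d\to\mathbb{C}$ have support $E=\mathrm{supp}(f)$, and suppose the Fourier coefficients $\hat f(m)$ for $m$ in a set $S\subseteq\mathbb{Z}_N^d$ are unobserved. Suppose there are constants $K\ge 0$ and $2\le\alpha\le 3$ such that every subset $T\subseteq\mathbb{Z}_N^d$ with $|T|\le 2|E|$ satisfies $\Lambda_2(T)\le K|T|^\alpha$. If \[ |E|^3\left(\Lambda_2(S)-|S|(|S|-1)\left[1-\sqrt{\frac{K}{(2|E|)^{3-\alpha}}}\sqrt{\frac{N^d}{2|E||S|}}\right]-|S|^2\left(1-\frac{N^d}{2|E||S|}\right)\right)<\frac{N^{3d}}{8}, \] then $f$ can be uniquely recovered, i.e. every function $g:\mathbb{Z}_N^d\to\mathbb{C}$ with $|\mathrm{supp}(g)|=|E|$ and $\hat g(m)=\hat f(m)$ for all $m\notin S$ satisfies $g=f$.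
   Context: $\mathbb{Z}_N=\mathbb{Z}/N\mathbb{Z}$. The discrete Fourier transform of $f:\mathbb{Z}_N^d\to\mathbb{C}$ is $\hat f(m)=N^{-d/2}\sum_{x\in\mathbb{Z}_N^d}f(x)e^{-2\pi i\, m\cdot x/N}$. The support of a function is the set of points where it is nonzero. For $A\subseteq\mathbb{Z}_N^d$, the additive energy is $\Lambda_2(A)=\#\{(x_1,x_2,x_3,x_4)\in A^4: x_1+x_2=x_3+x_4\}$. *)

(* Defs.v *)
From HB Require Import structures.
From mathcomp Require Import all_boot all_order all_algebra.
From mathcomp Require Import reals exp trigo.
From mathcomp Require Export complex.
Set Implicit Arguments. Unset Strict Implicit. Unset Printing Implicit Defensive.
Import Order.TTheory GRing.Theory Num.Theory.
Local Open Scope ring_scope.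
Local Open Scope complex_scope.

(* The group Z_N^d, as row vectors over 'Z_N (use with N >= 2). *)
Notation ZNd N d := 'rV['Z_N]_d.

Section Defs.
Variable R : realType.
Variables N d : nat.

Definition expi (t : R) : R[i] := (cos t) +i* (sin t).

(* m . x as a natural number (representatives in {0,...,N-1}); since the
   character is N-periodic, reducing mod N is unnecessary. *)
Definition dotZ (m x : ZNd N d) : nat := (\sum_(j < d) (m ord0 j : nat) * (x ord0 j : nat))%N.

Definition dft (f : ZNd N d -> R[i]) (m : ZNd N d) : R[i] :=
  ((Num.sqrt (N%:R ^+ d : R))^-1)%:C *
  \sum_(x : ZNd N d) f x * expi (- (2 * pi * (dotZ m x)%:R / N%:R)).

Definition supp (f : ZNd N d -> R[i]) : {set ZNd N d} := [set x | f x != 0].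

Definition energy (A : {set ZNd N d}) : nat :=
  #|[set p : ZNd N d * ZNd N d * ZNd N d * ZNd N d |
      [&& p.1.1.1 \in A, p.1.1.2 \in A, p.1.2 \in A, p.2 \in A &
          p.1.1.1 + p.1.1.2 == p.1.2 + p.2]]|.
End Defs.

(* Main.v *)
Require Import Defs.
From HB Require Import structures.
From mathcomp Require Import all_boot all_order all_algebra.
From mathcomp Require Import reals exp trigo complex.
From mathcomp Require Import ring lra.
Set Implicit Arguments.
Unset Strict Implicit.
Unset Printing Implicit Defensive.
Import Order.TTheory GRing.Theory Num.Theory.
Import ComplexField.Normc.
Local Open Scope ring_scope.

(** If [g] and [f] agree off [S] on the Fourier side, [h = g - f] is supported on a
    set [T] with [t = |T| <= 2 |E|] and its transform [F] is supported on [S]. Let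
    [M = N ^ d], with [F] unnormalised. By Parseval applied to [F * F],
      [M ^ 3 ||h||_4 ^ 4 <= sum of |F(m1) F(m2) F(m3) F(m4)| over m1 + m2 = m3 + m4].
    A nontrivial quadruple of [S] contributes at most
    [||h||_1 ^ 4 <= t ^ 3 ||h||_4 ^ 4]. The [s ^ 2] quadruples [(x, y, x, y)]
    contribute [||F||_2 ^ 4 = M ^ 2 ||h||_2 ^ 4 <= M ^ 2 t ||h||_4 ^ 4]. The
    [s (s - 1)] quadruples [(x, y, y, x)] with [x <> y] contribute at most
    [(s - 1) ||F||_4 ^ 4], and Cauchy-Schwarz over the additive quadruples of [T]
    gives [||F||_4 ^ 4 <= M sqrt (energy T * t) ||h||_4 ^ 4]. With the uncertainty
    principle [M <= t s], a nonzero [h] contradicts the hypothesis. *)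

(** * Cauchy-Schwarz and sums over finite types *)

Lemma cauchy_schwarz_sum (R : realFieldType) (I : finType) (P : pred I)
    (u v : I -> R) :
  (\sum_(i | P i) u i * v i) ^+ 2 <=
  (\sum_(i | P i) u i ^+ 2) * (\sum_(i | P i) v i ^+ 2).
Proof.
set W := \sum_(i | P i) u i * v i; set U := \sum_(i | P i) u i ^+ 2.
set V := \sum_(i | P i) v i ^+ 2.
(* Lagrange's identity: this double sum equals [2 * (U * V - W ^+ 2)]. *)
have : 0 <= \sum_(i | P i) \sum_(j | P j) (u i * v j - u j * v i) ^+ 2.
  by apply: sumr_ge0 => i _; apply: sumr_ge0 => j _; apply: sqr_ge0.
have -> : \sum_(i | P i) \sum_(j | P j) (u i * v j - u j * v i) ^+ 2 =
    U * V - 2 * W ^+ 2 + V * U.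
  transitivity (\sum_(i | P i) (u i ^+ 2 * V - 2 * W * (u i * v i) + v i ^+ 2 * U)).
    apply: eq_bigr => i _.
    transitivity (\sum_(j | P j) (u i ^+ 2 * v j ^+ 2
        + (- (2 * (u i * v i))) * (u j * v j) + v i ^+ 2 * u j ^+ 2)).
      by apply: eq_bigr => j _; ring.
    by rewrite !big_split /= -!mulr_sumr -/U -/V -/W; ring.
  by rewrite !big_split /= sumrN -!mulr_suml -mulr_sumr -/U -/V -/W; ring.
by move=> h; lra.
Qed.

Lemma sqr_sum_le_card (R : realFieldType) (I : finType) (A : {set I})
    (u : I -> R) :
  (\sum_(i in A) u i) ^+ 2 <= #|A|%:R * \sum_(i in A) u i ^+ 2.
Proof.
have := @cauchy_schwarz_sum R I [in A] (fun=> 1) u.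
under eq_bigr do rewrite mul1r.
by under [X in _ <= X * _]eq_bigr do rewrite expr1n; rewrite sumr_const.
Qed.

Lemma sum_supported (V : zmodType) (I : finType) (A : {set I}) (u : I -> V) :
  (forall i, i \notin A -> u i = 0) -> \sum_i u i = \sum_(i in A) u i.
Proof.
by move=> u0; rewrite [RHS]big_mkcond; apply: eq_bigr => i _; case: ifPn => // /u0.
Qed.

(** Expanding each square pairs up the points of one fibre of [s]. With [s] the addition map, sums
    over additive quadruples become square norms of convolutions. *)
Lemma sum_sqr_fibers (R : pzRingType) (I J : finType) (s : I -> J) (w : I -> R) :
  \sum_(q : I * I | s q.1 == s q.2) w q.1 * w q.2 =
  \sum_y (\sum_(u | s u == y) w u) ^+ 2.
Proof.
under [RHS]eq_bigr do rewrite expr2 big_distrlr /=.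
rewrite -(pair_big_dep xpredT (fun u v => s u == s v) (fun u v => w u * w v)) /=.
rewrite (partition_big s xpredT) //=; apply: eq_bigr => y _.
by apply: eq_bigr => u /eqP ->; apply: eq_bigl => v; rewrite eq_sym.
Qed.

(** * Additive quadruples and weighted additive energy *)

Section AdditiveQuadruples.
Variables (G : finZmodType) (R : realFieldType).
Implicit Types (A : {set G}) (a : G -> R) (q : (G * G) * (G * G)).

Definition quads A : {set (G * G) * (G * G)} :=
  [set q | [&& q.1.1 \in A, q.1.2 \in A, q.2.1 \in A, q.2.2 \in A &
            q.1.1 + q.1.2 == q.2.1 + q.2.2]].

(** The additive energy of a weight; the indicator of [A] gives [#|quads A|]. *)
Definition energy_sum a : R :=
  \sum_(q : (G * G) * (G * G) | q.1.1 + q.1.2 == q.2.1 + q.2.2)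
    (a q.1.1 * a q.1.2) * (a q.2.1 * a q.2.2).

Lemma energy_sum_supported A a : (forall x, x \notin A -> a x = 0) ->
  energy_sum a = \sum_(q in quads A) (a q.1.1 * a q.1.2) * (a q.2.1 * a q.2.2).
Proof.
move=> a0; rewrite /energy_sum big_mkcond [RHS]big_mkcond; apply: eq_bigr => q _.
rewrite inE; case: ifP => _; last by rewrite !andbF.
rewrite andbT; case: ifPn => //.
by rewrite !negb_and => /or4P[] /a0 ->; rewrite ?(mul0r, mulr0).
Qed.

Lemma energy_sum_conv a :
  energy_sum a =
  \sum_y (\sum_(u : G * G | u.1 + u.2 == y) a u.1 * a u.2) ^+ 2.
Proof.
exact: (@sum_sqr_fibers R _ _ (fun u : G * G => u.1 + u.2) (fun u => a u.1 * a u.2)).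
Qed.

Lemma card_repr_le A (y : G) :
  (#|[set u : G * G | [&& u.1 \in A, u.2 \in A & (u.1 + u.2)%R == y]]|
   <= #|A|)%N.
Proof.
set B := [set _ | _]; have inj : {in B &, injective (@fst G G)}.
  move=> [u1 u2] [v1 v2]; rewrite !inE /=.
  move=> /and3P[_ _ /eqP <-] /and3P[_ _ /eqP e] e1; move: e; rewrite e1 => /addrI ->.
  by [].
rewrite -(card_in_imset inj); apply/subset_leq_card/subsetP => x /imsetP[u].
by rewrite inE => /and3P[u1 _ _] ->.
Qed.

Lemma sum_pair_mul a : \sum_(u : G * G) a u.1 * a u.2 = (\sum_x a x) ^+ 2.
Proof. by rewrite expr2 big_distrlr /= pair_big. Qed.

(** Each sum [y] has at most [#|A|] representations in [A], so Cauchy-Schwarz on each fibre costs a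
    factor [#|A|]; the fibres then add up to an unrestricted double sum. *)
Lemma energy_sum_sqr_le A a : (forall x, x \notin A -> a x = 0) ->
  energy_sum (fun x => a x ^+ 2) <= #|A|%:R * (\sum_x a x ^+ 4) ^+ 2.
Proof.
move=> a0; rewrite energy_sum_conv -sum_pair_mul mulr_sumr.
rewrite [leRHS](partition_big (fun u : G * G => u.1 + u.2) xpredT) //=.
apply: ler_sum => y _.
pose B := [set u : G * G | [&& u.1 \in A, u.2 \in A & u.1 + u.2 == y]].
have -> : \sum_(u : G * G | u.1 + u.2 == y) a u.1 ^+ 2 * a u.2 ^+ 2 =
    \sum_(u in B) a u.1 ^+ 2 * a u.2 ^+ 2.
  rewrite big_mkcond [RHS]big_mkcond; apply: eq_bigr => u _; rewrite inE.
  case: ifP => _; last by rewrite !andbF.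
  rewrite andbT; case: ifPn => //.
  by rewrite negb_and => /orP[] /a0 ->; rewrite expr0n ?(mul0r, mulr0).
apply: (le_trans (sqr_sum_le_card _ _)).
rewrite -mulr_sumr; apply: ler_pM => //.
- by apply: sumr_ge0 => u _; apply: sqr_ge0.
- by rewrite ler_nat card_repr_le.
rewrite big_mkcond [leRHS]big_mkcond; apply: ler_sum => u _; rewrite inE.
have -> : a u.1 ^+ 4 * a u.2 ^+ 4 = (a u.1 ^+ 2 * a u.2 ^+ 2) ^+ 2 by ring.
by case: (u.1 + u.2 == y); rewrite ?andbF //; case: ifP; rewrite ?sqr_ge0.
Qed.

(** Cauchy-Schwarz against the constant 1 on [quads A] leaves the energy sum of [a ^+ 2], which the
    previous bound controls. *)
Lemma energy_sum_le_quads A a : (forall x, x \notin A -> a x = 0) ->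
  energy_sum a ^+ 2 <= #|quads A|%:R * (#|A|%:R * (\sum_x a x ^+ 4) ^+ 2).
Proof.
move=> a0; rewrite (energy_sum_supported a0).
apply: (le_trans (sqr_sum_le_card _ _)); apply: ler_wpM2l => //.
apply: le_trans (energy_sum_sqr_le a0).
rewrite (@energy_sum_supported A); last by move=> x /a0 ->; rewrite expr0n.
by apply: ler_sum => q _; rewrite !exprMn.
Qed.

Lemma sum_off_diag A a :
  \sum_(u : G * G | [&& u.1 \in A, u.2 \in A & u.1 != u.2]) a u.1 ^+ 2 * a u.2 ^+ 2
  = (\sum_(x in A) a x ^+ 2) ^+ 2 - \sum_(x in A) a x ^+ 4.
Proof.
apply/eqP; rewrite eq_sym subr_eq eq_sym; apply/eqP.
rewrite expr2 big_distrlr /= pair_big /=.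
rewrite [RHS](bigID (fun u : G * G => u.1 != u.2)) /=; congr (_ + _).
  by apply: eq_bigl => u; rewrite andbA.
rewrite [RHS](eq_bigl (fun u : G * G => (u.1 \in A) && (u.2 == u.1))); last first.
  by move=> u; rewrite negbK eq_sym; case: eqP => [->|_]; rewrite ?andbF ?andbT ?andbb.
rewrite -(pair_big_dep [in A] (fun x y => y == x) (fun x y => a x ^+ 2 * a y ^+ 2)) /=.
by apply: eq_bigr => x _; rewrite big_pred1_eq -exprD.
Qed.

(* The trivial solutions (x, y, x, y) and (x, y, y, x), x != y, are weighted by
   the squares of [a] instead of the crude bound [B ^+ 4]. *)
Lemma energy_sum_le_diag A a (B : R) : (forall x, x \notin A -> a x = 0) ->
  (forall x, 0 <= a x <= B) ->
  energy_sum a <=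
    (#|quads A|%:R - #|A|%:R ^+ 2 - #|A|%:R * (#|A|%:R - 1)) * B ^+ 4
    + (\sum_(x in A) a x ^+ 2) ^+ 2 + (#|A|%:R - 1) * \sum_(x in A) a x ^+ 4.
Proof.
move=> a0 aB; pose D1 := [pred u : G * G | (u.1 \in A) && (u.2 \in A)].
pose D2 := [pred u : G * G | [&& u.1 \in A, u.2 \in A & u.1 != u.2]].
pose w (u : G * G) := a u.1 ^+ 2 * a u.2 ^+ 2.
(* [v q] is the loss in bounding one term by [B ^+ 4]. The bound follows by keeping this loss on the
   trivial solutions only. *)
pose v q := B ^+ 4 - (a q.1.1 * a q.1.2) * (a q.2.1 * a q.2.2).
have v_ge0 q : 0 <= v q.
  have aM (x y C : R) : 0 <= x <= C -> 0 <= y <= C -> 0 <= x * y <= C ^+ 2.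
    by move=> /andP[? ?] /andP[? ?]; rewrite mulr_ge0 //= expr2 ler_pM.
  have := aM _ _ _ (aM _ _ _ (aB q.1.1) (aB q.1.2)) (aM _ _ _ (aB q.2.1) (aB q.2.2)).
  by rewrite -exprM subr_ge0 => /andP[].
pose i1 (u : G * G) := (u, u); pose i2 (u : G * G) := (u, (u.2, u.1)).
have diag : \sum_(u | D1 u) v (i1 u) + \sum_(u | D2 u) v (i2 u) <= \sum_(q in quads A) v q.
  have -> : \sum_(u | D1 u) v (i1 u) = \sum_(q in i1 @: D1) v q.
    by rewrite big_imset //= => u u' _ _ [].
  have -> : \sum_(u | D2 u) v (i2 u) = \sum_(q in i2 @: D2) v q.
    by rewrite big_imset //= => u u' _ _ [].
  rewrite -bigU /=; last first.
    (* A common element would give [(x, y) = (y, x)], which [D2] excludes. *)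
    rewrite disjoint_subset; apply/subsetP => q /imsetP[u _ ->]; rewrite inE.
    apply/imsetP => -[[x y]]; rewrite inE /= => /and3P[_ _ /eqP xy] [-> [] /= e _].
    exact: xy.
  rewrite big_mkcond [leRHS]big_mkcond; apply: ler_sum => q _.
  case: ifP => [|_]; last by case: ifP.
  suff sub : q \in [predU i1 @: D1 & i2 @: D2] -> q \in quads A by move=> /sub ->.
  rewrite inE => /orP[] /imsetP[[x y]]; rewrite !inE /=.
    by move=> /andP[xA yA] ->; rewrite /= xA yA eqxx.
  by move=> /and3P[xA yA _] ->; rewrite /= xA yA addrC eqxx.
rewrite (energy_sum_supported a0).
have card1 : #|D1|%:R = #|A|%:R ^+ 2 :> R.
  rewrite -natrX -[in RHS]mulnn -cardsX -[in RHS]cardsE; congr (_%:R).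
  by apply: eq_card => u; rewrite !inE.
have card2 : #|D2|%:R = #|A|%:R * (#|A|%:R - 1) :> R.
  (* For the constant weight 1 the off-diagonal sum counts [D2]. *)
  have := sum_off_diag A (fun=> 1); rewrite !expr1n mulr1 !sumr_const => ->.
  by rewrite mulrBr mulr1 expr2.
have eqL : \sum_(q in quads A) v q = #|quads A|%:R * B ^+ 4 -
    \sum_(q in quads A) (a q.1.1 * a q.1.2) * (a q.2.1 * a q.2.2).
  by rewrite /v sumrB sumr_const mulr_natl.
have eq1 : \sum_(u | D1 u) v (i1 u) = #|A|%:R ^+ 2 * B ^+ 4 - (\sum_(x in A) a x ^+ 2) ^+ 2.
  rewrite /v sumrB sumr_const -card1 mulr_natl; congr (_ - _).
  by rewrite expr2 big_distrlr /= pair_big; apply: eq_bigr => u _; rewrite /i1 /=; ring.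
have eq2 : \sum_(u | D2 u) v (i2 u) =
    #|A|%:R * (#|A|%:R - 1) * B ^+ 4 - \sum_(u | D2 u) w u.
  rewrite /v sumrB sumr_const -card2 mulr_natl; congr (_ - _).
  by apply: eq_bigr => u _; rewrite /w /i2 /=; ring.
(* Bounds the off-diagonal sum by [#|A| - 1] times the fourth moment. *)
have cs := sqr_sum_le_card A (fun x => a x ^+ 2); simpl in cs.
rewrite [X in _ <= _ * X](eq_bigr (fun x => a x ^+ 4)) in cs; last by move=> x _; rewrite -exprM.
move: diag; rewrite eqL eq1 eq2 sum_off_diag; move: cs => /=.
rewrite !mulrBl; lra.
Qed.
End AdditiveQuadruples.

(** * Characters and the unnormalised Fourier transform *)

Section Fourier.
Variables (R : realType) (N d : nat).
Hypothesis hN : (2 <= N)%N.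
Local Notation G := 'rV['Z_N]_d.
Implicit Types (f : G -> R[i]) (m x : G).

Lemma expiD (s t : R) : expi (s + t) = expi s * expi t.
Proof. by rewrite /expi cosD sinD; congr (Complex _ _); ring. Qed.

Lemma expiX (t : R) n : expi (t *+ n) = expi t ^+ n.
Proof.
elim: n => [|n IHn]; last by rewrite mulrS exprS expiD IHn.
by rewrite mulr0n expr0 /expi cos0 sin0.
Qed.

(** By the double angle formula, [cos t = 1] would force [sin (t / 2) = 0], yet [t / 2] lies
    strictly between 0 and [pi]. *)
Lemma expiN_neq1 (t : R) : 0 < t < 2 * pi -> expi (- t) != 1.
Proof.
move=> /andP[t0 t2pi]; apply/eqP => -[]; rewrite cosN => ct _.
have : 0 < sin (t / 2) by apply: sin_gt0_pi; apply/andP; split; lra.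
have := cosD (t / 2) (t / 2); have := cos2Dsin2 (t / 2).
have -> : t / 2 + t / 2 = t by lra.
by rewrite ct => h1 h2 h3; nra.
Qed.

(** With characters as powers of one root of unity, periodicity is a matter of exponents modulo
    [N]. *)
Definition omega : R[i] := expi (- (2 * pi / N%:R)).

Definition chi m x : R[i] := omega ^+ dotZ m x.

Definition hat f m : R[i] := \sum_x f x * chi m x.

Lemma N_neq0 : N%:R != 0 :> R.
Proof. by rewrite pnatr_eq0 -lt0n; apply: leq_trans hN. Qed.

Lemma dftE f m : dft f m = ((Num.sqrt (N%:R ^+ d : R))^-1)%:C%C * hat f m.
Proof.
congr (_ * _); apply: eq_bigr => x _; congr (_ * _).
by rewrite /chi /omega -expiX; congr expi; rewrite mulNrn -(mulr_natr (2 * pi / _)); ring.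
Qed.

Lemma omegaXN : omega ^+ N = 1.
Proof.
rewrite /omega -expiX mulNrn -(mulr_natr (2 * pi / _)) divfK ?N_neq0 // /expi cosN sinN.
by rewrite mulrC mulr_natr cos2pi sin2pi oppr0.
Qed.

Lemma omegaX_mod k l : k = l %[mod N] -> omega ^+ k = omega ^+ l.
Proof. by move=> kl; rewrite -(expr_mod k omegaXN) kl expr_mod ?omegaXN. Qed.

Lemma dotZC m x : dotZ m x = dotZ x m.
Proof. by apply: eq_bigr => j _; rewrite mulnC. Qed.

Lemma chiC m x : chi m x = chi x m.
Proof. by rewrite /chi dotZC. Qed.

(** The modulus built into ['Z_N] is [(Zp_trunc N).+2], which is [N] because [2 <= N]. *)
Lemma Zp_addE (a b : 'Z_N) : (a + b : 'Z_N) = ((a + b) %% N)%N :> nat.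
Proof. by congr (_ %% _)%N; apply: Zp_cast. Qed.

Lemma chiDl m m' x : chi (m + m') x = chi m x * chi m' x.
Proof.
rewrite /chi -exprD; apply: omegaX_mod; rewrite /dotZ -big_split /=.
elim/big_ind2: _ => // [k k' l l' e e'|j _]; first by rewrite -modnDm e e' modnDm.
by rewrite -mulnDl mxE Zp_addE modnMml.
Qed.

Lemma chi0l x : chi 0 x = 1.
Proof. by rewrite /chi /dotZ big1 // => j _; rewrite mxE. Qed.

Lemma chiDr m x x' : chi m (x + x') = chi m x * chi m x'.
Proof. by rewrite !(chiC m) chiDl. Qed.

Lemma normr_omega : `|omega| = 1.
Proof. by rewrite normc_def /omega /expi /= cos2Dsin2 sqrtr1. Qed.

Lemma normr_chi m x : `|chi m x| = 1.
Proof. by rewrite normrX normr_omega expr1n. Qed.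

(** Both sides are inverse to [chi m x], a number of modulus one. *)
Lemma conj_chi m x : (chi m x)^* = chi (- m) x.
Proof.
have chi0 : chi m x != 0 by rewrite -normr_eq0 normr_chi oner_neq0.
apply: (mulfI chi0); rewrite -normCK normr_chi expr1n -chiDl.
by rewrite subrr chi0l.
Qed.

Lemma card_G : #|{: G}| = (N ^ d)%N.
Proof. by rewrite card_mx mul1n card_ord Zp_cast. Qed.

(** If [m != 0], some basis vector [e] has [chi m e != 1]. Translation by [e] multiplies the sum by
    [chi m e], so the sum vanishes. *)
Lemma sum_chi m : \sum_x chi m x = (#|{: G}|%:R : R[i]) *+ (m == 0).
Proof.
have [->|m0] := eqVneq m 0.
  by under eq_bigr do rewrite chi0l; rewrite sumr_const mulr1n.
have [j mj] : exists j, m ord0 j != 0.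
  by apply/existsP; apply: contraNT m0 => /existsPn mj; apply/eqP/rowP => j;
    apply/eqP; rewrite mxE; move: (mj j); rewrite negbK.
pose e : G := delta_mx ord0 j.
have chi_e : chi m e != 1.
  have -> : chi m e = omega ^+ (m ord0 j : nat).
    rewrite /chi /dotZ (bigD1 j) //= big1 => [|i ij].
      by rewrite mxE !eqxx /= addn0 modn_small ?muln1 // Zp_cast.
    by rewrite mxE (negbTE ij) andbF muln0.
  (* A nonzero coordinate has its representative strictly between 0 and [N], which puts the angle
     strictly between 0 and [2 * pi]. *)
  have km : (0 < (m ord0 j : nat) < N)%N.
    rewrite lt0n; apply/andP; split; first by [].
    by apply: leq_trans (ltn_ord _) _; rewrite Zp_cast.
  set k := (m ord0 j : nat) in km *; move: km => /andP[k0 kN].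
  have NR : 0 < N%:R :> R by rewrite ltr0n (leq_trans _ hN).
  have kR : 0 < k%:R :> R by rewrite ltr0n.
  have kNR : k%:R < N%:R :> R by rewrite ltr_nat.
  have pi0 := pi_gt0 R.
  have pi2 : 0 < 2 * pi :> R by rewrite mulr_gt0.
  rewrite -expiX mulNrn -(mulr_natr (2 * pi / _)) mulrAC; apply: expiN_neq1.
  by rewrite divr_gt0 ?mulr_gt0 //= ltr_pdivrMr // ltr_pM2l.
rewrite mulr0n; apply/eqP; have : (1 - chi m e) * \sum_x chi m x = 0.
  rewrite mulrBl mul1r mulr_sumr [X in X - _](reindex_inj (addrI e)) /=.
  by apply/eqP; rewrite subr_eq0; apply/eqP; apply: eq_bigr => x _; rewrite chiDr.
by move/eqP; rewrite mulf_eq0 subr_eq0 eq_sym (negbTE chi_e).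
Qed.

(** * Parseval and inversion, with the real-valued modulus [normc] *)

Lemma normrE_normc (z : R[i]) : `|z| = (normc z)%:C%C.
Proof. by case: z => a b; rewrite normc_def. Qed.

Lemma parseval f :
  \sum_m normc (hat f m) ^+ 2 = #|{: G}|%:R * \sum_x normc (f x) ^+ 2.
Proof.
apply: complexI; rewrite rmorphM !rmorph_sum rmorph_nat /=.
under eq_bigr do rewrite rmorphXn /= -normrE_normc normCK /hat rmorph_sum big_distrlr /=.
rewrite exchange_big mulr_sumr; apply: eq_bigr => x _.
rewrite rmorphXn /= -normrE_normc normCK exchange_big /=.
(* Orthogonality of characters leaves only the diagonal [y = x]. *)
transitivity (\sum_y f x * (f y)^* * (#|{: G}|%:R *+ (x - y == 0))).
  apply: eq_bigr => y _; rewrite -sum_chi mulr_sumr; apply: eq_bigr => m _.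
  by rewrite rmorphM /= !(chiC m) conj_chi chiDl; ring.
rewrite (bigD1 x) //= subrr eqxx mulr1n big1 ?addr0 => [|y yx]; first by ring.
by rewrite subr_eq0 eq_sym (negbTE yx) mulr0n mulr0.
Qed.

(** Fourier inversion up to reflection: orthogonality leaves only [y = - x]. *)
Lemma hat_hat f x : hat (hat f) x = #|{: G}|%:R * f (- x).
Proof.
rewrite /hat; under eq_bigr do rewrite mulr_suml.
rewrite exchange_big /=.
transitivity (\sum_y f y * (#|{: G}|%:R *+ (x + y == 0))).
  apply: eq_bigr => y _; rewrite -sum_chi mulr_sumr; apply: eq_bigr => m _.
  by rewrite chiDl (chiC m); ring.
rewrite (bigD1 (- x)) //= subrr eqxx mulr1n big1 ?addr0 => [|y yx]; first by ring.
by rewrite addrC addr_eq0 (negbTE yx) mulr0n mulr0.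
Qed.

Lemma normc_sum (I : finType) (P : pred I) (F : I -> R[i]) :
  normc (\sum_(i | P i) F i) <= \sum_(i | P i) normc (F i).
Proof.
elim/big_ind2: _ => // [|x x' y y' h h']; first by rewrite normc0.
by apply: (le_trans (le_normcD _ _)); apply: lerD.
Qed.

Lemma normc_chi m x : normc (chi m x) = 1.
Proof. by apply: complexI; rewrite -normrE_normc normr_chi. Qed.

Lemma normc_ge0 (z : R[i]) : 0 <= normc z.
Proof. by case: z => a b; apply: sqrtr_ge0. Qed.

Lemma normc_hat_le f m : normc (hat f m) <= \sum_x normc (f x).
Proof.
apply: (le_trans (normc_sum _ _)); apply: ler_sum => x _.
by rewrite normcM normc_chi mulr1.
Qed.

(** * Self-convolution, fourth moments and the uncertainty principle *)

Definition conv f x : R[i] := \sum_(u : G * G | u.1 + u.2 == x) f u.1 * f u.2.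

Lemma hat_conv f m : hat (conv f) m = hat f m ^+ 2.
Proof.
rewrite expr2 big_distrlr /= pair_big /=.
rewrite (partition_big (fun u : G * G => u.1 + u.2) xpredT) //=.
apply: eq_bigr => y _; rewrite mulr_suml; apply: eq_bigr => u /eqP <-.
by rewrite chiDr; ring.
Qed.

Lemma energyE (A : {set G}) : energy A = #|quads A|.
Proof.
pose r (p : G * G * G * G) : (G * G) * (G * G) := (p.1.1, (p.1.2, p.2)).
have r_inj : injective r by move=> [[[? ?] ?] ?] [[[? ?] ?] ?] [-> -> -> ->].
rewrite /energy -(card_imset _ r_inj); apply: eq_card => -[[x1 x2] [x3 x4]].
apply/imsetP/idP => [[p] + ->|]; rewrite !inE //= => xA.
by exists (x1, x2, x3, x4); rewrite ?inE.
Qed.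

Lemma card_G_gt0 : 0 < #|{: G}|%:R :> R.
Proof. by rewrite ltr0n; apply/card_gt0P; exists 0. Qed.

(* The square of the transform is the transform of the self-convolution, so
   Parseval computes the fourth moment. *)
Lemma sum_normc_hat4_le f :
  \sum_m normc (hat f m) ^+ 4 <= #|{: G}|%:R * energy_sum (fun x => normc (f x)).
Proof.
have -> : \sum_m normc (hat f m) ^+ 4 = \sum_m normc (hat (conv f) m) ^+ 2.
  by apply: eq_bigr => m _; rewrite hat_conv expr2 normcM; ring.
rewrite parseval energy_sum_conv; apply: ler_wpM2l; first exact: ltW card_G_gt0.
apply: ler_sum => y _; rewrite ler_sqr ?nnegrE ?normc_ge0 ?sumr_ge0 // => [|u _].
  by apply: (le_trans (normc_sum _ _)); apply: ler_sum => u _; rewrite normcM.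
by rewrite mulr_ge0 ?normc_ge0.
Qed.

(** The previous bound applied to [hat f]: inversion yields the fourth power of the group order on
    the left, and one factor cancels. *)
Lemma sum_normc4_le f :
  #|{: G}|%:R ^+ 3 * \sum_x normc (f x) ^+ 4 <= energy_sum (fun m => normc (hat f m)).
Proof.
have := sum_normc_hat4_le (hat f).
have -> : \sum_x normc (hat (hat f) x) ^+ 4 =
    #|{: G}|%:R * (#|{: G}|%:R ^+ 3 * \sum_x normc (f x) ^+ 4).
  rewrite (reindex_inj oppr_inj) /= mulrA -exprS mulr_sumr.
  apply: eq_bigr => x _; rewrite hat_hat opprK normcM exprMn; congr (_ ^+ _ * _).
  by apply: complexI; rewrite -normrE_normc normr_nat rmorph_nat.
by rewrite ler_pM2l ?card_G_gt0.
Qed.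

(** Upper bounds [q] and [L] stand for the size and energy of the support, since recovery only knows
    [#|supp h| <= 2 |E|]. The sign of the first quantity permits enlarging the support size to [q]
    in the last bound. *)
Lemma additive_uncertainty (h : G -> R[i]) (S : {set G}) (q L : R) :
  supp h != set0 -> (forall m, m \notin S -> hat h m = 0) ->
  #|supp h|%:R <= q -> (energy (supp h))%:R <= L ->
  let M := #|{: G}|%:R : R in let s := #|S|%:R : R in
  [/\ 0 <= (energy S)%:R - s ^+ 2 - s * (s - 1), M <= q * s &
    M ^+ 3 <= ((energy S)%:R - s ^+ 2 - s * (s - 1)) * q ^+ 3 + M ^+ 2 * q
              + (s - 1) * (M * Num.sqrt (L * q))].
Proof.
move=> /set0Pn[x0]; rewrite inE => hx0 hatS tq TL M s.
set D := _ - _ - _; rewrite energyE in D *; rewrite energyE in TL.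
set t := #|supp h|%:R in tq.
pose a x := normc (h x); pose b m := normc (hat h m).
have a_ge0 x : 0 <= a x by apply: normc_ge0.
have b_ge0 m : 0 <= b m by apply: normc_ge0.
have a0 x : x \notin supp h -> a x = 0.
  by rewrite inE negbK => /eqP; rewrite /a => ->; rewrite normc0.
have b0 m : m \notin S -> b m = 0 by move=> /hatS; rewrite /b => ->; rewrite normc0.
have ax0 : 0 < a x0.
  by rewrite lt_neqAle a_ge0 andbT eq_sym; apply: contra_neq hx0 => /eq0_normc.
have P_gt0 k : 0 < \sum_x a x ^+ k.
  rewrite (bigD1 x0) //= ltr_pwDl ?exprn_gt0 //.
  by apply: sumr_ge0 => x _; apply: exprn_ge0.
(* The diagonal bound for the zero weight and [B = 1] reads [0 <= D]. *)
have D_ge0 : 0 <= D.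
  have := @energy_sum_le_diag _ R S (fun=> 0) 1 (fun _ _ => erefl).
  rewrite lexx ler01 expr1n mulr1 => /(_ (fun=> isT)).
  rewrite !expr0n /= !big1 // expr0n /= mulr0 !addr0.
  by rewrite /energy_sum big1 // => p _; rewrite !mul0r.
have M0 : 0 < M := card_G_gt0.
have t0 : 0 < t by rewrite ltr0n; apply/card_gt0P; exists x0; rewrite inE.
set P1 := \sum_x a x; set P2 := \sum_x a x ^+ 2; set P4 := \sum_x a x ^+ 4.
have P2_gt0 : 0 < P2 := P_gt0 2%N.
have P4_gt0 : 0 < P4 := P_gt0 4%N.
have cs1 : P1 ^+ 2 <= t * P2.
  rewrite /P1 /P2 !(@sum_supported _ _ (supp h)) ?sqr_sum_le_card // => x /a0 -> //.
  by rewrite expr0n.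
have cs2 : P2 ^+ 2 <= t * P4.
  rewrite /P2 /P4 !(@sum_supported _ _ (supp h)) => [|x /a0 ->|x /a0 ->]; rewrite ?expr0n //.
  apply: (le_trans (sqr_sum_le_card _ _)).
  by under eq_bigr do rewrite -exprM.
have bP1 m : 0 <= b m <= P1 by rewrite b_ge0 normc_hat_le.
have sumb2 : \sum_(m in S) b m ^+ 2 = M * P2.
  by rewrite -sum_supported ?parseval // => m /b0 ->; rewrite expr0n.
have sumb4 : \sum_(m in S) b m ^+ 4 <= M * energy_sum a.
  rewrite -sum_supported => [|m /b0 ->]; last by rewrite expr0n.
  exact: sum_normc_hat4_le.
(* By Parseval [M * P2] is the sum of [b ^+ 2] over [S], hence at most
   [s * P1 ^+ 2 <= s * t * P2]. *)
have Mts : M <= t * s.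
  rewrite -(ler_pM2r P2_gt0) -sumb2.
  apply: (@le_trans _ _ (\sum_(m in S) P1 ^+ 2)).
    apply: ler_sum => m _; have /andP[? ?] := bP1 m.
    by rewrite ler_sqr ?nnegrE //; apply: sumr_ge0.
  by rewrite sumr_const -(mulr_natl (P1 ^+ 2)) (mulrC t) -mulrA ler_wpM2l.
have s1 : 1 <= s.
  rewrite ler1n lt0n; apply/eqP => s0; move: Mts.
  by rewrite /s s0 mulr0 leNgt M0.
have q0 : 0 < q := lt_le_trans t0 tq.
have L0 : 0 <= L := le_trans (ler0n _ _) TL.
have Ea_ge0 : 0 <= energy_sum a by apply: sumr_ge0 => p _; rewrite !mulr_ge0.
have Ea : energy_sum a <= Num.sqrt (L * q) * P4.
  rewrite -ler_sqr ?nnegrE ?mulr_ge0 ?sqrtr_ge0 ?(ltW P4_gt0) //.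
  rewrite exprMn sqr_sqrtr ?mulr_ge0 ?(ltW q0) //.
  apply: (le_trans (energy_sum_le_quads a0)); rewrite mulrA.
  by rewrite ler_wpM2r ?sqr_ge0 // ler_pM.
split=> //; first by apply: (le_trans Mts); rewrite ler_wpM2r // ler0n.
(* After multiplication by [P4], the right side dominates the diagonal bound with [B = P1] term by
   term. *)
rewrite -(ler_pM2r P4_gt0); apply: (le_trans (sum_normc4_le h)).
apply: (le_trans (energy_sum_le_diag b0 bP1)); rewrite -/D sumb2.
rewrite [leRHS]mulrDl [X in _ <= X + _]mulrDl.
apply: lerD; first apply: lerD.
- rewrite -mulrA ler_wpM2l //.
  have -> : P1 ^+ 4 = (P1 ^+ 2) ^+ 2 by rewrite -exprM.
  apply: (@le_trans _ _ ((t * P2) ^+ 2)).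
    by rewrite ler_sqr ?nnegrE ?sqr_ge0 // mulr_ge0 // ltW.
  rewrite exprMn; apply: (@le_trans _ _ (t ^+ 2 * (t * P4))).
    by rewrite ler_wpM2l // sqr_ge0.
  rewrite mulrA -exprSr ler_wpM2r // ?(ltW P4_gt0) //.
  by rewrite lerXn2r // nnegrE ltW.
- rewrite exprMn -(mulrA (M ^+ 2)) ler_wpM2l ?sqr_ge0 //; apply: (le_trans cs2).
  by rewrite ler_wpM2r // ltW.
rewrite -mulrA ler_wpM2l ?subr_ge0 //; apply: (le_trans sumb4).
by rewrite -mulrA ler_wpM2l // ltW.
Qed.

End Fourier.

(** * Unique recovery from the uncertainty principle *)

Theorem mainTheorem2 (R : realType) (N d : nat) (hN : (2 <= N)%N) (hd : (1 <= d)%N)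
  (f : 'rV['Z_N]_d -> R[i]) (S : {set 'rV['Z_N]_d}) (K alpha : R)
  (hK : 0 <= K) (ha2 : 2 <= alpha) (ha3 : alpha <= 3)
  (hadd : forall T : {set 'rV['Z_N]_d},
      (#|T| <= 2 * #|supp f|)%N -> (energy T)%:R <= K * (#|T|%:R `^ alpha))
  (hcond :
     let E := #|supp f|%:R : R in
     let s := #|S|%:R : R in
     let Nd := (N%:R ^+ d : R) in
     E ^+ 3 * ((energy S)%:R
               - s * (s - 1) * (1 - Num.sqrt (K / ((2 * E) `^ (3 - alpha)))
                                    * Num.sqrt (Nd / (2 * E * s)))
               - s ^+ 2 * (1 - Nd / (2 * E * s)))
     < N%:R ^+ (3 * d) / 8) :
  forall g : 'rV['Z_N]_d -> R[i],
    #|supp g| = #|supp f| ->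
    (forall m, m \notin S -> dft g m = dft f m) ->
    g =1 f.
Proof.
move=> g gf dftS x; apply/eqP; rewrite -subr_eq0; apply/negPn/negP => gfx.
pose h y := g y - f y.
have Ndgt0 : 0 < N%:R ^+ d :> R by rewrite exprn_gt0 // ltr0n (leq_trans _ hN).
have hatS m : m \notin S -> hat h m = 0.
  move=> /dftS; rewrite !dftE // => /mulfI e.
  rewrite /hat /h; under eq_bigr do rewrite mulrBl.
  rewrite sumrB; apply/eqP; rewrite subr_eq0; apply/eqP/e.
  by rewrite fmorph_eq0 invr_eq0 gt_eqF ?sqrtr_gt0.
have h0 : supp h != set0 by apply/set0Pn; exists x; rewrite inE.
have card_h : (#|supp h| <= 2 * #|supp f|)%N.
  rewrite mul2n -addnn -{1}gf; apply: leq_trans (leq_card_setU _ _).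
  apply/subset_leq_card/subsetP => y; rewrite !inE -negb_and; apply: contraNN.
  by rewrite /h => /andP[/eqP -> /eqP ->]; rewrite subrr.
pose E := #|supp f|%:R : R.
have [q qE] : exists q, q = 2 * E by exists (2 * E).
have tq : #|supp h|%:R <= q by rewrite qE /E -natrM ler_nat.
have t0 : 0 < #|supp h|%:R :> R by rewrite ltr0n card_gt0.
have q0 : 0 < q := lt_le_trans t0 tq.
have TL : (energy (supp h))%:R <= K * q `^ alpha.
  apply: (le_trans (hadd _ card_h)); rewrite ler_wpM2l //.
  by rewrite ge0_ler_powR // ?nnegrE ?ltW //; lra.
have cG : #|{: 'rV['Z_N]_d}|%:R = N%:R ^+ d :> R by rewrite card_G // natrX.
have [] := additive_uncertainty hN h0 hatS tq TL.
move: hcond; rewrite cG mulnC exprM /=; set M := N%:R ^+ d; set s := #|S|%:R.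
rewrite -/E -qE; set Y := Num.sqrt _ * Num.sqrt _; set D := _ - s ^+ 2 - _ => hc D0 Mqs bound.
have M0 : 0 < M by [].
have s0 : 0 < s.
  by rewrite lt0r ler0n andbT; apply: contraTneq Mqs => ->; rewrite mulr0 -ltNge.
have s1 : 0 <= s - 1 by rewrite subr_ge0 ler1n -(ltr0n R).
(* With L = K q^alpha, the quotient under the first root of [Y] is L / q^3. Squaring reduces the
   claim to M^2 L q <= M (q s) L q, which follows from [Mqs]. *)
have MY : M * Num.sqrt (K * q `^ alpha * q) <= q ^+ 3 * s * Y.
  have Kq0 : 0 <= K * q `^ alpha by rewrite mulr_ge0 // powR_ge0.
  have qpow : q `^ (3 - alpha) * q `^ alpha = q ^+ 3.
    by rewrite -powRD ?subrK ?powR_mulrn ?(ltW q0) // (gt_eqF q0) implybT.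
  have Kq : K / q `^ (3 - alpha) = K * q `^ alpha / q ^+ 3.
    by rewrite -qpow; field; rewrite !gt_eqF ?powR_gt0.
  rewrite /Y Kq -ler_sqr ?nnegrE ?mulr_ge0 ?sqrtr_ge0 ?exprn_ge0 ?(ltW M0)
    ?(ltW q0) ?(ltW s0) //.
  rewrite !exprMn !sqr_sqrtr ?mulr_ge0 ?powR_ge0 ?invr_ge0 ?mulr_ge0 ?exprn_ge0 ?(ltW M0)
    ?(ltW q0) ?(ltW s0) //.
  set L := K * _ in Kq0 *.
  have -> : q ^+ 2 * (q ^+ 2 * q ^+ 2) * s ^+ 2 * (L / q ^+ 3 * (M / (q * s))) = M * (q * s) * (L * q).
    by field; rewrite !gt_eqF.
  apply: ler_wpM2r; first by rewrite mulr_ge0 ?(ltW q0).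
  by rewrite expr2 ler_pM2l.
have MZ : M ^+ 2 * q <= q ^+ 3 * (s ^+ 2 * (M / (q * s))).
  have -> : q ^+ 3 * (s ^+ 2 * (M / (q * s))) = M * (q * s) * q.
    by field; rewrite !gt_eqF.
  by rewrite ler_pM2r // expr2 ler_pM2l.
have sMY := ler_wpM2l s1 MY.
set Z := M / _ in hc MZ.
(* As [q = 2 * E], the constant 8 in the hypothesis is absorbed into [q ^+ 3]. *)
have e8 : E ^+ 3 = q ^+ 3 / 8 by rewrite qE; field.
move: hc; rewrite e8 => hc.
have : q ^+ 3 * (D + s * (s - 1) * Y + s ^+ 2 * Z) < M ^+ 3.
  have -> : D + s * (s - 1) * Y + s ^+ 2 * Z =
      (energy S)%:R - s * (s - 1) * (1 - Y) - s ^+ 2 * (1 - Z) by rewrite /D; ring.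
  lra.
(* [MZ] and [sMY] enlarge the last two terms of [bound] to those of the hypothesis, giving the
   opposite inequality. *)
rewrite ltNge => /negP; apply; apply: (le_trans bound).
have -> : q ^+ 3 * (D + s * (s - 1) * Y + s ^+ 2 * Z) =
    D * q ^+ 3 + q ^+ 3 * (s ^+ 2 * Z) + (s - 1) * (q ^+ 3 * s * Y) by ring.
by rewrite lerD // lerD.
Qed.
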